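(* Let $G$ be a finite simple triangle-free graph with at least one edge. Then for every integer $n\ge 3$, $$\chi_i'(S_G^3)\le \chi_i'(S_G^n)\le \chi_i'(S_G^3)+1.$$ Moreover, writing $k=\chi_i'(S_G^3)$, we have $\chi_i'(S_G^n)=\chi_i'(S_G^3)$ for all $n\ge 3$ whenever at least one of the following holds: (i) there is an injective edge $k$-coloring of $S_G^3$ such that every vertex of $S_G^3$ incident to an edge of color $k$ is at distance at least $3$ (in $S_G^3$) from every extreme vertex $(u,u,u)$, $u\in V(G)$; or (ii) $G$ is bipartite with bipartition $V(G)=A\cup B$, and there is an injective edge $k$-coloring of $S_G^3$ such that for every $u\in A$ all edges incident with the extreme vertex $(u,u,u)$ receive color $k$, and every vertex of $S_G^3$ incident to an edge of color $k$ is at distance at least $2$ (in $S_G^3$) from every extreme vertex $(v,v,v)$ with $v\in B$.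
   Context: For a graph $H$ with at least one edge, an injective edge $k$-coloring is a map $c:E(H)\to\{1,\dots,k\}$ such that whenever $e_1=xy$, $e_2=yz$, $e_3=zu$ are edges of $H$ with $x,y,z$ distinct and $u\notin\{y,z\}$ (the case $u=x$ being allowed), we have $c(e_1)\ne c(e_3)$. The injective chromatic index $\chi_i'(H)$ is the least $k$ for which such a coloring exists. For a graph $G$ and positive integer $n$, the generalized Sierpiński graph $S_G^n$ has vertex set $V(G)^n$, and $(u_1,\dots,u_n)$, $(v_1,\dots,v_n)$ are adjacent if and only if there is $d\in\{1,\dots,n\}$ with $u_i=v_i$ for $i<d$, $u_dv_d\in E(G)$, and $u_i=v_d$, $v_i=u_d$ for all $i>d$. The extreme vertices of $S_G^n$ are the vertices $(u,\dots,u)$, $u\in V(G)$. *)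

(* Defs.v *)
From Stdlib Require Import ClassicalEpsilon.
From mathcomp Require Import all_boot.
Set Implicit Arguments. Unset Strict Implicit. Unset Printing Implicit Defensive.

Definition simple_graph (T : finType) (e : rel T) : Prop :=
  symmetric e /\ irreflexive e.

Definition triangle_free (T : finType) (e : rel T) : Prop :=
  forall x y z, e x y -> e y z -> ~ e z x.

Definition has_edge (T : finType) (e : rel T) : Prop := exists x y, e x y.

Definition sierpinski (T : finType) (e : rel T) (n : nat) : rel {ffun 'I_n -> T} :=
  fun u v => [exists d : 'I_n,
    [&& [forall i : 'I_n, (i < d) ==> (u i == v i)],
        e (u d) (v d) &
        [forall i : 'I_n, (d < i) ==> ((u i == v d) && (v i == u d))]]].

Arguments sierpinski {T} e n.

Definition extreme (T : finType) (n : nat) (u : T) : {ffun 'I_n -> T} :=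
  [ffun _ => u].
Arguments extreme {T} n u.

Definition inj_edge_coloring (V : finType) (H : rel V) (k : nat)
    (c : V -> V -> nat) : Prop :=
  (forall x y, H x y -> c x y = c y x /\ 1 <= c x y <= k) /\
  (forall x y z u, H x y -> H y z -> H z u ->
     x != y -> y != z -> x != z -> u != y -> u != z -> c x y <> c z u).

Definition inj_colorable (V : finType) (H : rel V) (k : nat) : Prop :=
  exists c, inj_edge_coloring H k c.

Definition inj_colorableb (V : finType) (H : rel V) (k : nat) : bool :=
  if excluded_middle_informative (inj_colorable H k) then true else false.

Lemma inj_colorableb_ex (V : finType) (H : rel V) :
  (exists k, inj_colorable H k) -> exists k, inj_colorableb H k.
Proof.
case=> k Hk; exists k; rewrite /inj_colorableb.
by case: excluded_middle_informative.
Qed.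

Definition inj_chromatic_index (V : finType) (H : rel V) : nat :=
  match excluded_middle_informative (exists k, inj_colorable H k) with
  | left P => ex_minn (inj_colorableb_ex P)
  | right _ => 0
  end.

Fixpoint walk_le (V : finType) (H : rel V) (l : nat) (x y : V) : bool :=
  match l with
  | 0 => x == y
  | l'.+1 => (x == y) || [exists z, H x z && walk_le H l' z y]
  end.

(* dist_H(x,y) >= d  (infinite distance allowed) *)
Definition dist_ge (V : finType) (H : rel V) (d : nat) (x y : V) : Prop :=
  forall l, l < d -> ~~ walk_le H l x y.

(* Main.v *)
From Stdlib Require Import ClassicalEpsilon.
Require Import Defs.
From mathcomp Require Import all_boot.
From mathcomp Require Import zify.
Set Implicit Arguments. Unset Strict Implicit. Unset Printing Implicit Defensive.

(* S^n is a union of copies of S^3 joined by connecting edges between extreme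
   vertices. Choose one end of each connecting edge as a center, colour every
   edge at a center with one colour K, and all other edges by a fixed colouring
   of S^3. Centers are at distance at least 4 from each other, so this is an
   injective colouring as soon as K is not used by the fixed colouring close to
   the extreme vertices: K = k + 1 always works, and K = k works in case (i)
   for any choice of centers. In case (ii) the centers are the ends in A; the
   extreme vertices uuu with u in A of degree at least 2 cause no trouble since
   their edges already have colour k, but if x in A is a leaf with neighbour y,
   then edges at xxy may have colour k. Such colourings are first repaired:
   the subgraph xS^2 is attached to the rest of S^3 by a single edge, and it
   can be recoloured after the model of yS^2, where k does not occur near yyy. *)

(** * Basic facts on injective edge colourings and the injective chromatic index *)

Section InjectiveColoring.

Lemma inj_edge_coloring_comp (V W : finType) (H : rel V) (K : rel W) (f : V -> W)
    (k : nat) (c : W -> W -> nat) :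
  injective f -> (forall x y, H x y -> K (f x) (f y)) ->
  inj_edge_coloring K k c -> inj_edge_coloring H k (fun x y => c (f x) (f y)).
Proof.
move=> fI fH [c1 c2]; split=> [x y /fH|x y z u /fH xy /fH yz /fH zu]; first exact: c1.
by rewrite -!(inj_eq fI); apply: c2.
Qed.

(** Every edge can have a colour of its own: the rank of its set of ends, shifted by one since
    colours start at 1. *)
Lemma inj_colorable_all (V : finType) (H : rel V) : exists k, inj_colorable H k.
Proof.
exists #|{set V}|.+1, (fun x y => (enum_rank [set x; y]).+1).
split=> [x y _|x y z u _ _ _ _ yz _ uy _].
  by rewrite [[set y; x]]setUC; split=> //=; rewrite ltnS ltnW.
move=> [] /ord_inj /enum_rank_inj /setP /(_ y).
by rewrite !inE eqxx orbT (negPf yz) eq_sym (negPf uy).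
Qed.

(** The default value 0 in the definition never occurs, as every finite graph has a colouring. *)
Lemma inj_chromatic_indexP (V : finType) (H : rel V) :
  inj_colorable H (inj_chromatic_index H) /\
  forall k, inj_colorable H k -> inj_chromatic_index H <= k.
Proof.
rewrite /inj_chromatic_index; case: excluded_middle_informative => [P|]; last first.
  by case; apply: inj_colorable_all.
case: ex_minnP => m; rewrite {1}/inj_colorableb.
case: excluded_middle_informative => // mP _ mmin; split=> // k kP.
by apply: mmin; rewrite /inj_colorableb; case: excluded_middle_informative.
Qed.

(** In a loopless graph the other disequalities asked of a path follow from adjacency. *)
Lemma inj_edge_coloring_neq (V : finType) (H : rel V) k c x y z u :
  irreflexive H -> inj_edge_coloring H k c -> H x y -> H y z -> H z u ->
  x <> z -> y <> u -> c x y <> c z u.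
Proof.
move=> Hi [_ c2] xy yz zu /eqP xz /eqP; rewrite eq_sym => uy.
apply: c2 => //; apply: contraTneq isT => E; first by rewrite E Hi in xy.
  by rewrite E Hi in yz.
by rewrite E Hi in zu.
Qed.

End InjectiveColoring.

(** * The graph S^3 on triples *)

Section CubeGraph.
Variables (T : finType) (e : rel T).

(** The graph [sierpinski e 3] on triples; the disjuncts put the index [d] at the third, second and
    first coordinate. *)
Definition sierpinski3 : rel (T * T * T) := fun p q =>
  let: (a, b, c) := p in let: (a', b', c') := q in
  [|| [&& a == a', b == b' & e c c'],
      [&& a == a', e b b', c == b' & c' == b] |
      [&& e a a', b == a', c == a', b' == a & c' == a]].

Lemma sierpinski3P a b c q :
  reflect [\/ exists2 c', q = (a, b, c') & e c c',
              q = (a, c, b) /\ e b c |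
              [/\ b = c, q = (b, a, a) & e a b]]
          (sierpinski3 (a, b, c) q).
Proof.
case: q => [[a' b'] c'] /=; apply: (iffP or3P).
  case=> [/and3P[/eqP<- /eqP<- ?]|/and4P[/eqP<- ? /eqP-> /eqP->]|/and5P[? /eqP-> /eqP-> /eqP-> /eqP->]].
  - by apply: Or31; exists c'.
  - exact: Or32.
  - exact: Or33.
case=> [[z [-> -> ->] cz]|[[-> -> ->] bc]|[<- [-> -> ->] ab]].
- by apply: Or31; rewrite !eqxx.
- by apply: Or32; rewrite !eqxx bc.
- by apply: Or33; rewrite !eqxx ab.
Qed.

Lemma sierpinski3_sym : symmetric e -> symmetric sierpinski3.
Proof.
move=> es; suff H p q : sierpinski3 p q -> sierpinski3 q p by move=> p q; apply/idP/idP; exact: H.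
case: p => [[a b] c] /sierpinski3P[[z -> cz]|[-> bc]|[<- -> ab]]; apply/sierpinski3P.
- by apply: Or31; exists c; rewrite // es.
- by apply: Or32; rewrite es.
- by apply: Or33; rewrite es.
Qed.

Lemma sierpinski3_irr : irreflexive e -> irreflexive sierpinski3.
Proof.
move=> ei [[a b] c]; apply/sierpinski3P.
by case=> [[z [->]]|[[->]]|[_ [->]]]; rewrite ei.
Qed.

Lemma sierpinski3_extreme a q : irreflexive e -> sierpinski3 (a, a, a) q ->
  exists2 z, q = (a, a, z) & e a z.
Proof. by move=> ei /sierpinski3P[[z ? ?]|[_]|[_ _]]; rewrite ?ei //; exists z. Qed.

End CubeGraph.

(** * Leaves of the part A *)

Section Leaf.
Variables (T : finType) (e : rel T).
Hypotheses (es : symmetric e) (ei : irreflexive e).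
Variables (x y : T) (k : nat) (c : T * T * T -> T * T * T -> nat).
Local Notation s3 := (sierpinski3 e).
Hypotheses (exy : e x y) (leafx : forall z, e x z -> z = y).
Hypothesis cP : inj_edge_coloring s3 k c.
Hypothesis ky : forall z q, z = y \/ e y z -> s3 (y, y, z) q -> c (y, y, z) q <> k.

Let a := c (y, y, x) (y, x, y).
Let b := c (y, y, y) (y, y, x).

(* The copies yxG and xxG are recoloured like yyG, where k is free within
   distance 1 of y; exchanging a and b makes the edge (yyx, yxy) of colour a
   compatible both with its other end and with the recoloured copy. *)
Definition leaf_swap (i : nat) := if i == a then b else if i == b then a else i.

(** Carries xS^2 onto its model yS^2. *)
Definition leaf_fold (p : T * T * T) :=
  let: (p1, p2, p3) := p in (if p1 == x then y else p1, p2, p3).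

Definition in_leaf_copy (p : T * T * T) := p.1 == (y, x).

(** Within yxG the only edge at yxx is (yxx, yxy). It gets colour k, which (xxx, xxy) then inherits
    by folding. *)
Definition leaf_copy_recoloring p q :=
  if in_leaf_copy p && in_leaf_copy q then
    if (p.2 == x) || (q.2 == x) then k else leaf_swap (c (y, y, p.2) (y, y, q.2))
  else c p q.

(* As x is a leaf, (xyy, yxx) is the only edge that leaves xS^2; it gets
   colour k and xS^2 is coloured as yS^2. *)
Definition leaf_recoloring p q :=
  if (p.1.1 == x) != (q.1.1 == x) then k
  else leaf_copy_recoloring (leaf_fold p) (leaf_fold q).

Local Notation c1 := leaf_copy_recoloring.
Local Notation c2 := leaf_recoloring.

Let eyx : e y x. Proof. by rewrite es. Qed.
Let xNy : x <> y. Proof. by move=> E; move: exy; rewrite E ei. Qed.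
Let yNx : y <> x. Proof. by move=> E; apply: xNy. Qed.
Let leafx' z : e z x -> z = y. Proof. by rewrite es; apply: leafx. Qed.
Let si := sierpinski3_irr ei.
Let ss := sierpinski3_sym es.
Let cN p q r s : s3 p q -> s3 q r -> s3 r s -> p <> r -> q <> s -> c p q <> c r s.
Proof. exact: (@inj_edge_coloring_neq _ s3 k c p q r s si cP). Qed.
Let csym p q : s3 p q -> c p q = c q p. Proof. by case: cP => H _ /H[]. Qed.

Let s31 p1 p2 p3 q3 : e p3 q3 -> s3 (p1, p2, p3) (p1, p2, q3).
Proof. by move=> H; apply/sierpinski3P; apply: Or31; exists q3. Qed.
Let s32 p1 p2 p3 : e p2 p3 -> s3 (p1, p2, p3) (p1, p3, p2).
Proof. by move=> H; apply/sierpinski3P; apply: Or32. Qed.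

Let aNk : a <> k. Proof. by apply: ky; [right | apply: s32]. Qed.
Let bNk : b <> k. Proof. by apply: ky; [left | apply: s31]. Qed.

Lemma leaf_swap_inj : injective leaf_swap.
Proof.
apply: (can_inj (g := leaf_swap)) => i; rewrite /leaf_swap.
case: (eqVneq i a) => [->|ia]; first by case: (eqVneq b a); rewrite ?eqxx.
by case: (eqVneq i b) => [->|/negPf ->]; rewrite ?eqxx // (negPf ia).
Qed.

Lemma leaf_swapk i : leaf_swap i = k -> i = k.
Proof.
rewrite /leaf_swap; case: eqP => _; first by move/bNk.
by case: eqP => _ // /aNk.
Qed.

Lemma leaf_swapa i : leaf_swap i = a -> i = b.
Proof. by rewrite /leaf_swap; case: eqP => [-> ->|n] //; case: eqP => // _ /n. Qed.

Lemma leaf_swapb i : leaf_swap i = b -> i = a.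
Proof. by rewrite /leaf_swap; case: eqP => [-> //|n]; case: eqP => [-> ->|m /m]. Qed.

Let s3_light u v : s3 (y, x, u) (y, x, v) -> e u v.
Proof.
case/sierpinski3P => [[z [-> //]]|[[<- _]]|[_ [/yNx//]]].
by rewrite ei.
Qed.

Lemma leaf_copy_recoloring_sym p q : s3 p q -> c1 p q = c1 q p.
Proof.
case: p q => [[p1 p2] p3] [[q1 q2] q3] /= pq; rewrite /c1 /in_leaf_copy /= andbC.
case: ifP; last by rewrite csym.
rewrite orbC => /andP[/eqP[E1 E2] /eqP[E3 E4]]; case: ifP => // _; congr leaf_swap; apply: csym.
by subst; apply: s31; apply: s3_light.
Qed.

Let c1_light p3 q3 : c1 (y, x, p3) (y, x, q3) =
  if (p3 == x) || (q3 == x) then k else leaf_swap (c (y, y, p3) (y, y, q3)).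
Proof. by rewrite /c1 /in_leaf_copy /= eqxx. Qed.

(** Outside xS^2, the copy yxG is left only through (yxy, yyx), of colour [a], which continues only
    with (yyx, yyy), of colour [b]. As the swap exchanges [a] and [b], a clash would pull back to a
    clash of [c] around yyG. *)
Lemma leaf_copy_recoloring_mixed p q r s :
  s3 p q -> s3 q r -> s3 r s -> p <> r -> q <> s -> r.1.1 <> x -> s.1.1 <> x ->
  in_leaf_copy p -> in_leaf_copy q -> ~~ (in_leaf_copy r && in_leaf_copy s) ->
  c1 p q <> c1 r s.
Proof.
case: p q => [[p1 p2] p3] [[q1 q2] q3] pq qr rs pr qs rx sx /eqP[E1 E2] /eqP[E3 E4].
move: pq qr pr qs; rewrite {}E1 {}E2 {}E3 {}E4 => /s3_light epq qr pr qs rsl.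
have -> : c1 r s = c r s by rewrite /c1 (negPf rsl).
rewrite c1_light; case/sierpinski3P: qr => [[z Er ez]|[Er /leafx E]|[_ Er _]]; last by rewrite Er in rx.
  rewrite Er in pr rsl rs rx *; case/sierpinski3P: rs => [[t Es _]|[Es /leafx E]|[_ Es _]].
  - by move: rsl; rewrite Es /in_leaf_copy /= !eqxx.
  (* The path leaves the copy on its last edge: r is yxy and s is yyx. *)
  - move: pr; rewrite Es E => pr; rewrite E in ez.
    have q3x : q3 <> x by move=> E'; apply: pr; rewrite (leafx (z := p3)) // -E' es.
    have p3x : p3 <> x.
      by move=> E'; move: epq ez; rewrite E' => /leafx ->; rewrite ei.
    case: eqP => //= _; case: eqP => //= _; rewrite (csym (s32 y exy)) => /leaf_swapa.
    by apply: cN; [exact: s31 | exact: s31 | exact: s31 | case=> E'; apply: pr; rewrite E' | case].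
  - by rewrite Es in sx.
(* The path leaves the copy on its middle edge: q is yxy, r is yyx, hence s is yyy. *)
move: Er epq pr qs; rewrite {}E => {q3} Er epq pr qs.
rewrite Er in rs rx pr rsl *; case/sierpinski3P: rs => [[t Es /leafx E]|[Es _]|[/yNx //]]; last by rewrite Es in qs.
rewrite Es E (csym (s31 y y exy)); have -> : (y == x) = false by apply/eqP.
rewrite orbF; case: eqP => [_|p3x /leaf_swapb]; first by move/esym/bNk.
by apply: cN; [exact: s31 | exact: s31 | exact: s32 | case | case].
Qed.

Lemma leaf_copy_recoloring_neq p q r s :
  s3 p q -> s3 q r -> s3 r s -> p <> r -> q <> s ->
  p.1.1 <> x -> q.1.1 <> x -> r.1.1 <> x -> s.1.1 <> x -> c1 p q <> c1 r s.
Proof.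
move=> pq qr rs pr qs px qx rx sx.
case: (boolP (in_leaf_copy p && in_leaf_copy q)) => [/andP[pl ql]|pql];
  case: (boolP (in_leaf_copy r && in_leaf_copy s)) => [/andP[rl sl]|rsl].
- case: p q r s pl ql rl sl pq qr rs pr qs {px qx rx sx} =>
    [[p1 p2] p3] [[q1 q2] q3] [[r1 r2] r3] [[t1 t2] t3].
  move=> /eqP[-> ->] /eqP[-> ->] /eqP[-> ->] /eqP[-> ->].
  move=> /s3_light pq /s3_light qr /s3_light rs pr qs; rewrite !c1_light.
  have p3r3 : p3 <> r3 by move=> E; rewrite E in pr.
  have q3t3 : q3 <> t3 by move=> E; rewrite E in qs.
  (* Inner vertices of a path have two neighbours on it, so they are not the leaf. *)
  have q3x : q3 == x = false.
    by apply/eqP => E; apply: p3r3; move: pq qr; rewrite E => /leafx' -> /leafx ->.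
  have r3x : r3 == x = false.
    by apply/eqP => E; apply: q3t3; move: qr rs; rewrite E => /leafx' -> /leafx ->.
  rewrite q3x r3x /= orbF; case: eqP => [E|_]; case: eqP => [E'|_].
  - by move: pq rs qr; rewrite E E' => /leafx -> /leafx' ->; rewrite ei.
  (* If [p3] is the leaf, [q3] is y and [r3] is a neighbour of y, where [ky] excludes k. *)
  - move/esym/leaf_swapk; apply: ky; last exact: s31.
    by right; move: qr; rewrite (leafx (z := q3)) // -E.
  - move/leaf_swapk; rewrite csym; last exact: s31.
    apply: ky; last by apply: s31; rewrite es.
    by right; move: qr; rewrite es (leafx' (z := r3)) // -E'.
  - move/leaf_swap_inj; by apply: cN; [exact: s31 | exact: s31 | exact: s31 | case | case].
- exact: leaf_copy_recoloring_mixed.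
- move/esym; rewrite (leaf_copy_recoloring_sym rs) (leaf_copy_recoloring_sym pq).
  by apply: leaf_copy_recoloring_mixed; rewrite // 1?ss // 1?andbC // => /esym.
- by rewrite /c1 (negPf pql) (negPf rsl); apply: cN.
Qed.

Let cross p q : s3 p q -> (p.1.1 == x) != (q.1.1 == x) ->
  p = (x, y, y) /\ q = (y, x, x) \/ p = (y, x, x) /\ q = (x, y, y).
Proof.
have H p' q' : s3 p' q' -> p'.1.1 = x -> q'.1.1 <> x -> p' = (x, y, y) /\ q' = (y, x, x).
  case: p' => [[a1 a2] a3] /sierpinski3P[[z -> _]|[-> _]|[<- -> /= ea]] //= E; rewrite ?E //.
  by move: ea; rewrite E => /leafx ->.
move=> pq; case: (eqVneq p.1.1 x) => px; case: (eqVneq q.1.1 x) => // qx _.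
  by left; apply: H => //; apply/eqP.
by right; rewrite ss in pq; case: (H q p pq qx) => //; apply/eqP.
Qed.

Let fold_adj p q : s3 p q -> (p.1.1 == x) = (q.1.1 == x) -> s3 (leaf_fold p) (leaf_fold q).
Proof.
case: p => [[p1 p2] p3] /sierpinski3P[[z -> ez]|[-> ez]|[<- -> e12]] /= E.
- exact: s31.
- exact: s32.
- move: E e12; case: (eqVneq p1 x) => [->|n]; case: (eqVneq p2 x) => [->|m] // _.
    by rewrite ei.
  by move=> E; rewrite E !eqxx !orbT.
Qed.

Let fold_inj p q : (p.1.1 == x) = (q.1.1 == x) -> leaf_fold p = leaf_fold q -> p = q.
Proof.
case: p q => [[p1 p2] p3] [[q1 q2] q3] /=.
case: (eqVneq p1 x) => [->|_] /esym; last by move=> ->.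
by move=> E; rewrite E => -[-> ->]; rewrite (eqP E).
Qed.

Let fold_neq p : (leaf_fold p).1.1 <> x.
Proof. by case: p => [[p1 p2] p3] /=; case: eqP. Qed.

Let c1_heavy z s : c1 (y, y, z) s = c (y, y, z) s.
Proof. by rewrite /c1 /in_leaf_copy /=; case: eqP => // -[/yNx]. Qed.

Let c2_same p q : (p.1.1 == x) = (q.1.1 == x) -> c2 p q = c1 (leaf_fold p) (leaf_fold q).
Proof. by move=> E; rewrite /c2 E eqxx. Qed.

Lemma leaf_recoloring_sym p q : s3 p q -> c2 p q = c2 q p.
Proof.
move=> pq; rewrite /c2 eq_sym; case: ifP => // /eqP E.
by apply: leaf_copy_recoloring_sym; apply: fold_adj.
Qed.

(** On both sides of the bridge the next edge but one is coloured after an edge at yyy or at a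
    neighbour of yyy, where [ky] excludes k. *)
Lemma leaf_recoloring_cross_neq p q r s : s3 p q -> s3 q r -> s3 r s -> p <> r -> q <> s ->
  (p.1.1 == x) != (q.1.1 == x) -> c2 r s <> k.
Proof.
move=> pq qr rs pr qs /(cross pq)[] [Ep Eq]; subst.
  case/sierpinski3P: qr => [[z Er /leafx E]|[_]|[_ Er]]; last by rewrite Er in pr.
    rewrite {}Er {}E in rs pr *; case/sierpinski3P: rs => [[w Es eyw]|[Es _]|[/xNy //]].
      rewrite Es c2_same //= (introF eqP yNx) c1_light (introF eqP yNx).
      case: eqP => [E|_ /= /leaf_swapk]; first by rewrite Es E in qs.
      by apply: ky; [left | apply: s31].
    rewrite Es c2_same //= (introF eqP yNx) leaf_copy_recoloring_sym; last exact: s32.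
    by rewrite c1_heavy.
  by rewrite ei.
case/sierpinski3P: qr => [[z Er ez]|[_]|[_ Er]]; last by rewrite Er in pr.
  have E : (r.1.1 == x) = (s.1.1 == x).
    rewrite Er /= eqxx; rewrite Er in rs.
    case/sierpinski3P: rs => [[w -> _]|[-> _]|[E]]; rewrite /= ?eqxx //.
    by rewrite E ei in ez.
  rewrite c2_same //; have := fold_adj rs E; rewrite Er /= eqxx c1_heavy.
  by apply: ky; right.
by rewrite ei.
Qed.

(** Behind yxx comes only (yxx, yxy), of colour k; an edge at xyy inside xS^2 is coloured after an
    edge at yyy, which does not have colour k. *)
Lemma leaf_recoloring_bridge_neq p q r s : s3 p q -> s3 q r -> s3 r s -> p <> r -> q <> s ->
  q = (x, y, y) -> r = (y, x, x) -> c2 p q <> c2 r s.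
Proof.
move=> + + + + + Eq Er; rewrite Eq Er ss => qp _ rs pr qs.
have -> : c2 (y, x, x) s = k.
  case/sierpinski3P: rs => [[z -> /leafx ->]|[_]|[_ Es]]; rewrite ?ei //; last by rewrite Es in qs.
  by rewrite c2_same //= (introF eqP yNx) c1_light eqxx.
case/sierpinski3P: qp => [[z -> ez]|[_]|[_ Ep]]; rewrite ?ei //.
by rewrite c2_same //= eqxx c1_heavy; apply: ky; [right | apply: s31; rewrite es].
Qed.

Let crange p q : s3 p q -> 1 <= c p q <= k. Proof. by case: cP => H _ /H[]. Qed.

Lemma leaf_recoloringP : inj_edge_coloring s3 k c2.
Proof.
split=> [p q pq|p q r s pq qr rs _ _ /eqP pr /eqP sq _].
  split; first exact: leaf_recoloring_sym.
  have k1 : 1 <= k <= k by have /andP[k1 /(leq_trans k1)] := crange pq; rewrite leqnn andbT.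
  rewrite /c2; case: ifP => // /negbFE /eqP /(fold_adj pq).
  move: (leaf_fold p) (leaf_fold q) => [[p1 p2] p3] [[q1 q2] q3] E; rewrite /c1 /in_leaf_copy /=.
  case: ifP => [/andP[/eqP[E1 E2] /eqP[E3 E4]]|_]; last exact: crange.
  case: ifP => // _; rewrite /leaf_swap; subst.
  by do !case: ifP => _; apply: crange; rewrite ?s31 ?s32 ?(s3_light E).
have qs : q <> s by move/esym.
(* The bridge may be the first, the last or the middle edge of the path, or not occur in it. *)
case: (boolP ((p.1.1 == x) != (q.1.1 == x))) => pqx.
  have := leaf_recoloring_cross_neq pq qr rs pr qs pqx.
  by rewrite {2}/c2 pqx => /nesym.
case: (boolP ((r.1.1 == x) != (s.1.1 == x))) => rsx.
  rewrite {2}/c2 rsx leaf_recoloring_sym //.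
  by apply: (@leaf_recoloring_cross_neq s r q p); rewrite // 1?ss // 1?eq_sym // => /esym.
case: (boolP ((q.1.1 == x) != (r.1.1 == x))) => qrx.
  case: (cross qr qrx) => -[Eq Er]; first exact: leaf_recoloring_bridge_neq.
  rewrite (leaf_recoloring_sym pq) (leaf_recoloring_sym rs); apply: nesym.
  by apply: (@leaf_recoloring_bridge_neq s r q p); rewrite // 1?ss // => /esym.
(* Without the bridge, the path folds injectively enough to a path outside xS^2. *)
move/negPn/eqP: pqx => pqx; move/negPn/eqP: rsx => rsx; move/negPn/eqP: qrx => qrx.
rewrite !c2_same //; apply: leaf_copy_recoloring_neq; rewrite ?fold_adj //.
  by move/fold_inj => E; apply: pr; apply: E; rewrite pqx.
by move/fold_inj => E; apply: qs; apply: E; rewrite qrx.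
Qed.

Lemma leaf_recoloring_id p q : p.1.1 <> x -> q.1.1 <> x ->
  ~~ (in_leaf_copy p && in_leaf_copy q) -> c2 p q = c p q.
Proof.
case: p q => [[p1 p2] p3] [[q1 q2] q3] /= /eqP/negPf px /eqP/negPf qx l.
by rewrite c2_same /= ?px ?qx // /c1 (negPf l).
Qed.

Lemma leaf_recoloring_extreme q : s3 (x, x, x) q -> c2 (x, x, x) q = k.
Proof.
case/sierpinski3P => [[z -> /leafx ->]|[_]|[_ _]]; rewrite ?ei //.
by rewrite c2_same //= eqxx c1_light eqxx.
Qed.

(** This is what [isolated_star] asks at x, whose only neighbour is y. The vertex xxy folds to yxy,
    whose edges other than (yxy, yxx) have swapped colours of edges at yyy or the colour [a]. *)
Lemma leaf_recoloring_good q : s3 (x, x, y) q -> q <> (x, x, x) -> c2 (x, x, y) q <> k.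
Proof.
case/sierpinski3P => [[z -> ez]|[-> _]|[/xNy //]].
  move=> n; rewrite c2_same //= eqxx c1_light (introF eqP yNx) /=.
  case: eqP => [E|_ /leaf_swapk]; first by rewrite E in n.
  by apply: ky; [left | apply: s31].
by rewrite c2_same //= eqxx leaf_copy_recoloring_sym ?c1_heavy //; apply: s32.
Qed.

End Leaf.

(** * Colourings as in case (ii) and the repair of all leaves *)

Section Bipartite.
Variables (T : finType) (e : rel T).
Hypotheses (es : symmetric e) (ei : irreflexive e).
Variables (A : {set T}) (k : nat).
Hypothesis eA : forall x y, e x y -> (x \in A) != (y \in A).
Local Notation s3 := (sierpinski3 e).

(** The colourings of case (ii), on triples: the vertices at distance at most 1 from (v,v,v) are the
    (v,v,z) with z equal or adjacent to v. *)
Definition extremal_coloring (c : T * T * T -> T * T * T -> nat) :=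
  [/\ inj_edge_coloring s3 k c,
      forall u q, u \in A -> s3 (u, u, u) q -> c (u, u, u) q = k &
      forall v z q, v \notin A -> z = v \/ e v z -> s3 (v, v, z) q -> c (v, v, z) q <> k].

(* If u in A has two neighbours, extremality forces this; for a leaf it may
   fail, and then the connecting edge at (u,...,u) could not get colour k. *)
Definition isolated_star (c : T * T * T -> T * T * T -> nat) (u : T) :=
  forall z q, e u z -> s3 (u, u, z) q -> q <> (u, u, u) -> c (u, u, z) q <> k.

(** If w is a second neighbour of u, then (uuw, uuu) has colour k and is joined to (uuz, q) by the
    edge (uuu, uuz). *)
Lemma isolated_star_deg2 c u z1 z2 : extremal_coloring c -> u \in A ->
  e u z1 -> e u z2 -> z1 <> z2 -> isolated_star c u.
Proof.
case=> cP cA _ uA ez1 ez2 z12 z q ez zq qu.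
have [w ew wz] : exists2 w, e u w & w <> z.
  by case: (eqVneq z1 z) => [<-|/eqP]; [exists z2 => // /esym | exists z1].
have uw : s3 (u, u, w) (u, u, u) by apply/sierpinski3P; apply: Or31; exists u; rewrite // es.
have uz : s3 (u, u, u) (u, u, z) by apply/sierpinski3P; apply: Or31; exists z.
have E : c (u, u, w) (u, u, u) = k.
  by case: cP => [/(_ _ _ uw)[-> _] _]; apply: cA; rewrite // sierpinski3_sym.
rewrite -E; apply: nesym.
apply: (inj_edge_coloring_neq (sierpinski3_irr ei) cP uw uz zq); last exact: nesym.
by case.
Qed.

(** The recolouring changes no edge that the conditions at a vertex other than x speak of, so
    repairs of different leaves do not interfere. *)
Lemma extremal_leaf_recoloring c x y : extremal_coloring c -> x \in A -> e x y ->
  (forall z, e x z -> z = y) ->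
  exists c', [/\ extremal_coloring c', isolated_star c' x &
    forall u, u \in A -> u != x -> isolated_star c u -> isolated_star c' u].
Proof.
case=> cP cA cB xA exy leafx.
have yA : y \notin A by have := eA exy; rewrite xA; case: (y \in A).
have ky z q : z = y \/ e y z -> s3 (y, y, z) q -> c (y, y, z) q <> k by apply: cB.
have yx : y <> x by move=> E; rewrite E xA in yA.
pose c' := leaf_recoloring x y k c; exists c'.
(* Such an edge has both ends outside xS^2 and does not lie in yxG. *)
have idc u z q : u <> x -> s3 (u, u, z) q -> z = u \/ e u z -> c' (u, u, z) q = c (u, u, z) q.
  move=> ux uq zu; apply: leaf_recoloring_id => //.
    case/sierpinski3P: uq zu => [[w -> _]|[-> _]|[<- _]] //.
    by move=> + [E|]; rewrite ?ei // E ei.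
  by rewrite /in_leaf_copy /=; apply/andP => -[/eqP[-> /yx]].
split; last first.
- move=> u uA /eqP ux gu z q uz zq; rewrite idc //; last by right.
  exact: gu.
- by move=> z q /leafx ->; apply: leaf_recoloring_good.
split.
- exact: (leaf_recoloringP es ei exy leafx cP ky).
- move=> u q uA; case: (eqVneq u x) => [->|/eqP ux] uq.
    exact: leaf_recoloring_extreme.
  by rewrite idc //; [apply: cA | left].
- move=> v z q vA vz zq; rewrite idc //; first exact: cB.
  by move=> E; rewrite E xA in vA.
Qed.

(** The leaves in A are repaired one after another; elements of A of any other degree satisfy the
    condition at once. *)
Lemma extremal_isolated_star c : extremal_coloring c ->
  exists2 c', extremal_coloring c' & forall u, u \in A -> isolated_star c' u.
Proof.
move=> cP; suff H (s : seq T) : exists2 c', extremal_coloring c' &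
    forall u, u \in s -> u \in A -> isolated_star c' u.
  by have [c' c'P c's] := H (enum T); exists c' => // u; apply: c's; rewrite mem_enum.
elim: s => [|x s [c' c'P c's]]; first by exists c.
case: (boolP (x \in A)) => xA; last first.
  by exists c' => // u /[1!inE] /predU1P[->|/c's //]; rewrite (negPf xA).
case: (pickP (e x)) => [y exy|x0]; last first.
  by exists c' => // u /[1!inE] /predU1P[-> _ z q|/c's //]; rewrite x0.
case: (pickP [pred z | e x z & z != y]) => [z /andP[exz /eqP zy]|leafx].
  by exists c' => // u /[1!inE] /predU1P[-> _|/c's //]; apply: (isolated_star_deg2 c'P xA exz exy).
have [|c'' [c''P gx gu]] := extremal_leaf_recoloring c'P xA exy.
  by move=> z xz; apply/eqP; have := leafx z; rewrite /= xz /= => /negbFE.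
exists c'' => // u /[1!inE]; case: (eqVneq u x) => [-> //|ux] /= us uA.
by apply: gu => //; apply: c's.
Qed.

End Bipartite.

(** * Gluing copies of S^3 *)

Section Glue.
Variables (T : finType) (e : rel T).
Hypotheses (es : symmetric e) (ei : irreflexive e).
Local Notation s3 := (sierpinski3 e).

Lemma sierpinski_sym n : symmetric (sierpinski e n).
Proof.
suff H u v : sierpinski e n u v -> sierpinski e n v u by move=> u v; apply/idP/idP; exact: H.
case/existsP=> d /and3P[/forallP uv euv /forallP vu]; apply/existsP; exists d; apply/and3P; split.
- by apply/forallP => i; rewrite eq_sym.
- by rewrite es.
- by apply/forallP => i; rewrite andbC.
Qed.

Section Suffix.
Variable m : nat.
Implicit Types u v : {ffun 'I_(m + 3) -> T}.

Definition suffix3 u : T * T * T :=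
  (u (rshift m ord0), u (rshift m (inord 1)), u (rshift m ord_max)).

(** Edges whose index [d] lies in the prefix: they join extreme vertices of two copies of S^3. *)
Definition link u v := exists d : 'I_m,
  [/\ forall i : 'I_(m + 3), i < d -> u i = v i, e (u (lshift 3 d)) (v (lshift 3 d)) &
      forall i : 'I_(m + 3), d < i -> u i = v (lshift 3 d) /\ v i = u (lshift 3 d)].

Definition inner u v := (forall i : 'I_m, u (lshift 3 i) = v (lshift 3 i)) /\ s3 (suffix3 u) (suffix3 v).

Lemma suffix3_inj u v : (forall i : 'I_m, u (lshift 3 i) = v (lshift 3 i)) ->
  suffix3 u = suffix3 v -> u = v.
Proof.
move=> uv [E0 E1 E2]; apply/ffunP => i; case: (splitP i) => [j|[[|[|[|j]]] //= lj]] Ei.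
- by have -> : i = lshift 3 j by exact: val_inj.
- by have -> : i = rshift m ord0 by exact: val_inj.
- by have -> : i = rshift m (inord 1) by apply: val_inj; rewrite /= inordK.
- by have -> : i = rshift m ord_max by exact: val_inj.
Qed.

Lemma sierpinski_link_inner u v : sierpinski e (m + 3) u v -> link u v \/ inner u v.
Proof.
case/existsP=> d /and3P[/forallP uv euv /forallP vu].
have {}uv (i : 'I_(m + 3)) : i < d -> u i = v i by move=> id; apply/eqP; apply: (implyP (uv i)).
have {}vu (i : 'I_(m + 3)) : d < i -> u i = v d /\ v i = u d.
  by move=> id; have /andP[/eqP ? /eqP] := implyP (vu i) id.
case: (splitP d) => [d' Ed|j Ed].
  left; exists d'; have E : lshift 3 d' = d by exact: val_inj.
  by rewrite E; split => // i; rewrite -Ed; [apply: uv | apply: vu].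
right; split=> [i|]; first by apply: uv; rewrite Ed /= ltn_addr.
have {}Ed : d = rshift m j by exact: val_inj.
rewrite {}Ed in uv euv vu; apply/sierpinski3P; rewrite /suffix3.
case: j euv uv vu => [[|[|[|j]]] //= lj] euv uv vu.
- have E : Ordinal lj = ord0 by exact: val_inj.
  rewrite E in euv vu.
  have [-> ->] := vu (rshift m (inord 1)) ltac:(by rewrite /= inordK //; lia).
  by have [-> ->] := vu (rshift m ord_max) ltac:(by rewrite /=; lia); apply: Or33.
- have E : Ordinal lj = inord 1 by apply: val_inj; rewrite /= inordK.
  rewrite E in euv vu.
  have -> := uv (rshift m ord0) ltac:(by rewrite /=; lia).
  by have [E1 E2] := vu (rshift m ord_max) ltac:(by rewrite /=; lia); apply: Or32; rewrite E1 E2.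
- have E : Ordinal lj = ord_max by exact: val_inj.
  rewrite E in euv.
  have -> := uv (rshift m ord0) ltac:(by rewrite /=; lia).
  have -> := uv (rshift m (inord 1)) ltac:(by rewrite /= inordK //; lia).
  by apply: Or31; exists (v (rshift m ord_max)).
Qed.

Definition embed3 (t0 : T) (p : T * T * T) : {ffun 'I_(m + 3) -> T} :=
  [ffun i : 'I_(m + 3) => match split i with
    | inl _ => t0
    | inr j => nth t0 [:: p.1.1; p.1.2; p.2] j end].

Lemma embed3K t0 : cancel (embed3 t0) suffix3.
Proof.
case=> [[p1 p2] p3]; rewrite /suffix3 /embed3 !ffunE.
by rewrite !(unsplitK (inr _)) /= inordK.
Qed.

Lemma embed3_adj t0 p q : s3 p q -> sierpinski e (m + 3) (embed3 t0 p) (embed3 t0 q).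
Proof.
case: p => [[p1 p2] p3] pq.
have eP x y : e x y -> x <> y by move=> H E; rewrite E ei in H.
have Fl r (i : 'I_m) : embed3 t0 r (lshift 3 i) = t0 by rewrite ffunE (unsplitK (inl _)).
have Fr r (i : 'I_3) : embed3 t0 r (rshift m i) = nth t0 [:: r.1.1; r.1.2; r.2] i.
  by rewrite ffunE (unsplitK (inr _)).
(* The index of the edge is the first coordinate where the triples differ. *)
pose j : 'I_3 := if (p1, p2) == q.1 then ord_max else if p1 == q.1.1 then inord 1 else ord0.
apply/existsP; exists (rshift m j).
apply/and3P; split; [apply/forallP => i | | apply/forallP => i]; rewrite ?Fr;
  try (case: (split_ordP i) => i' ->; rewrite ?Fl ?Fr ?eqxx ?implybT //; try (apply/implyP; rewrite /=; lia)).
all: case/sierpinski3P: pq @j => [[z -> ez]|[-> ez]|[<- -> ez]] /=.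
all: rewrite ?xpair_eqE ?eqxx /= ?(introF eqP (@eP _ _ ez)) ?inordK ?andbF //=.
all: try (case: i' => [[|[|[|i']]] //= ?]; rewrite ?eqxx ?implybT //).
all: by apply/implyP; lia.
Qed.

Lemma link_sym u v : link u v -> link v u.
Proof.
case=> d [uv euv vu]; exists d; split=> [i /uv //||i /vu[] //].
by rewrite es.
Qed.

Let last3 := rshift m (@ord_max 2).

Let last3P (d : 'I_m) : d < last3. Proof. by rewrite /= ltn_addr. Qed.

(** Behind [d] the word u is constant, and at [d] it differs from that constant; so u determines
    [d], and then v. *)
Lemma link_uniq u v w : link u v -> link u w -> v = w.
Proof.
case=> d [uv dv vu] [d' [uw dw wu]].
have vwd (a b : 'I_m) (x y : {ffun 'I_(m + 3) -> T}) : e (u (lshift 3 b)) (y (lshift 3 b)) ->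
    (forall i : 'I_(m + 3), a < i -> u i = x (lshift 3 a) /\ x i = u (lshift 3 a)) ->
    (forall i : 'I_(m + 3), b < i -> u i = y (lshift 3 b) /\ y i = u (lshift 3 b)) ->
    ~ a < b.
  move=> yb xu yu ab; have [E _] := xu (lshift 3 b) ab; move: yb.
  have [E1 _] := xu _ (last3P a); have [E2 _] := yu _ (last3P b).
  by rewrite E -E1 -E2 ei.
have Ed : d = d'.
  apply: val_inj; case: (ltngtP d d') => // dd; first by case: (vwd d d' v w dw vu wu dd).
  by case: (vwd d' d w v dv wu vu dd).
subst d'; apply/ffunP => i; case: (ltngtP i d) => [id|id|id].
- by rewrite -uv // uw.
- by have [_ ->] := vu _ id; have [_ ->] := wu _ id.
- have -> : i = lshift 3 d by exact: val_inj.
  by have [<- _] := vu _ (last3P d); have [<- _] := wu _ (last3P d).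
Qed.

(* [P a b] selects the end with suffix aaa of the connecting edge between the
   suffixes aaa and bbb; edges at a center will all get the same colour. *)
Definition center (P : rel T) u := [exists d : 'I_m,
  [&& [forall i : 'I_(m + 3), (d < i) ==> (u i == u last3)],
      e (u last3) (u (lshift 3 d)) & P (u last3) (u (lshift 3 d))]].

Let suffix_const u (d : 'I_m) a : (forall i : 'I_(m + 3), d < i -> u i = a) -> suffix3 u = (a, a, a).
Proof. by move=> H; rewrite /suffix3 !H //= ltn_addr. Qed.

Lemma centerP P u : center P u -> exists a b, [/\ suffix3 u = (a, a, a), e a b & P a b].
Proof.
case/existsP => d /and3P[/forallP H H1 H2]; exists (u last3), (u (lshift 3 d)); split=> //.
apply: (@suffix_const u d) => i id; apply/eqP; exact: (implyP (H i) id).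
Qed.

(** The last index at which u differs from its tail is the only possible witness in [center]. *)
Lemma center_tail P u (d : 'I_m) a b : (forall i : 'I_(m + 3), d < i -> u i = a) ->
  u (lshift 3 d) = b -> e a b -> center P u = P a b.
Proof.
move=> ua ub eab; have ul : u last3 = a by apply: ua.
apply/existsP/idP => [[d' /and3P[/forallP H H1 H2]]|Pab]; last first.
  by exists d; rewrite ul ub eab Pab !andbT; apply/forallP => i; apply/implyP => /ua ->.
have Ed : d = d'; last by rewrite -Ed ul ub in H2.
apply: val_inj; case: (ltngtP d d') => // dd.
  by move: H1; rewrite (ua (lshift 3 d')) // ul ei.
by have /implyP/(_ dd)/eqP := H (lshift 3 d); rewrite ul ub => E; rewrite E ei in eab.
Qed.

Lemma link_center P u v : link u v -> exists a b,
  [/\ suffix3 u = (a, a, a), suffix3 v = (b, b, b), e a b, center P u = P a b & center P v = P b a].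
Proof.
case=> d [_ uvd uv]; exists (v (lshift 3 d)), (u (lshift 3 d)).
have evu : e (v (lshift 3 d)) (u (lshift 3 d)) by rewrite es.
split=> //; [apply: (@suffix_const u d) | apply: (@suffix_const v d) |
  apply: (@center_tail P u d) | apply: (@center_tail P v d)] => // i /uv[] //.
Qed.

(** * The glued colouring of S^n *)

Section GluedColoring.
Hypothesis etf : triangle_free e.
Variables (P : rel T) (k : nat) (c : T * T * T -> T * T * T -> nat).
Hypothesis Pasym : forall a b, e a b -> P a b = ~~ P b a.
Hypothesis k1 : 1 <= k.
Hypothesis cP : inj_edge_coloring s3 k c.
Hypothesis center_nbr : forall a b z t, e a b -> P a b ->
  s3 (a, a, a) z -> s3 z t -> t <> (a, a, a) -> c z t <> k.
Hypothesis center_dist2 : forall a b y z t, e a b -> P a b ->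
  s3 (a, a, a) y -> s3 y z -> s3 z t -> (a, a, a) <> z -> y <> t -> c z t <> k.
Hypothesis noncenter_nbr : forall a b z t, e a b -> ~~ P a b ->
  z = (a, a, a) \/ s3 (a, a, a) z -> s3 z t -> c z t <> k.

Definition glued_coloring u v :=
  if center P u || center P v then k else c (suffix3 u) (suffix3 v).

Local Notation S := (sierpinski e (m + 3)).
Local Notation Z := (center P).
Local Notation extr u := (exists a, suffix3 u = (a, a, a)).

Let s3_extreme a q : s3 (a, a, a) q -> exists2 z, q = (a, a, z) & e a z.
Proof. exact: sierpinski3_extreme. Qed.

Let centerE u : Z u -> extr u. Proof. by case/centerP => a [b [? _ _]]; exists a. Qed.

Let linkE u v : link u v -> extr u /\ extr v.
Proof. by case/(link_center P) => a [b [? ? _ _ _]]; split; [exists a | exists b]. Qed.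

Let link_centers u v : link u v -> Z u = ~~ Z v.
Proof. by case/(link_center P) => a [b [_ _ /Pasym + -> ->]]. Qed.

Let inner_far1 u v : inner u v -> extr u -> extr v -> False.
Proof.
case=> _ + [a Ea] [b Eb]; rewrite Ea Eb => /s3_extreme[z [E1 _ E3]].
by rewrite -E3 E1 ei.
Qed.

Let far1 u v : S u v -> extr u -> extr v -> link u v.
Proof. by move=> /sierpinski_link_inner[//|uv] ue /(inner_far1 uv ue). Qed.

(** A connecting edge has extreme ends, and an extreme vertex has at most one such edge; within a
    copy, all neighbours of (a,a,a) start with a. *)
Let far2 u v w : S u w -> S w v -> u <> v -> extr u -> extr v -> False.
Proof.
move=> /sierpinski_link_inner[] uw /sierpinski_link_inner[] wv uv ue ve.
- by apply: uv; apply: link_uniq (link_sym uw) wv.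
- by case/linkE: uw => _ /(inner_far1 wv); apply.
- by case/linkE: wv => /(inner_far1 uw ue).
case: uw wv => uw suw [wv swv]; case: ue ve => a Ea [b Eb].
rewrite Ea in suw; rewrite Eb sierpinski3_sym // in swv.
have [z Ew _] := s3_extreme suw; have [z' + _] := s3_extreme swv.
rewrite Ew => -[E _ _]; apply: uv; apply: suffix3_inj => [i|]; first by rewrite uw.
by rewrite Ea Eb E.
Qed.

(** Adjacent centers are excluded because a connecting edge has just one, and distance 2 is excluded
    by [far2]; distance 3 reduces to three inner edges. *)
Let center_path x y z t : S x y -> S y z -> S z t -> x <> z -> y <> t ->
  Z x || Z y -> Z z || Z t -> False.
Proof.
move=> xy yz zt xz yt.
(* Inner edges keep the prefix, and a path from aaa to bbb of length 3 forces a = b and a triangle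
   in G; here triangle-freeness enters. *)
have inner_yz : Z x -> Z t -> inner x y -> inner y z -> inner z t -> False.
  case/centerP=> a [_ [Ea _ _]] /centerP[b [_ [Eb _ _]]] [ixy sxy] [iyz syz] [izt szt].
  rewrite Ea in sxy; rewrite Eb sierpinski3_sym // in szt.
  have [w Ew ew] := s3_extreme sxy; have [w' Ew' ew'] := s3_extreme szt.
  rewrite Ew Ew' in syz; case/sierpinski3P: syz => [[r [E _ Er] wr]|[[E1 E2 _] _]|[E _ _]].
  - by subst b r; apply: (etf ew wr); rewrite es.
  - by rewrite -E2 E1 ei in ew.
  - by rewrite -E ei in ew.
case: (boolP (Z x)) => [/[dup] Zx /centerE xe _|/= nZx Zy].
  case: (boolP (Z z)) => [/centerE ze _|/= nZz Zt]; first exact: (far2 xy yz xz).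
  have te := centerE Zt.
  case: (sierpinski_link_inner xy) => [lxy|ixy].
    by case/linkE: lxy => _ ye; apply: (far2 yz zt yt).
  case: (sierpinski_link_inner zt) => [lzt|izt].
    by case/linkE: lzt => ze _; apply: (far2 xy yz xz).
  case: (sierpinski_link_inner yz) => [lyz|iyz]; last exact: inner_yz.
  by case/linkE: lyz => ye _; apply: (inner_far1 ixy).
have ye := centerE Zy.
case: (boolP (Z z)) => [Zz _|/= nZz /centerE te]; last exact: (far2 yz zt yt).
by have := link_centers (far1 yz ye (centerE Zz)); rewrite Zy Zz.
Qed.

(** If the center lies in another copy, the path enters the copy of z at an extreme vertex that is
    no center, and [noncenter_nbr] applies. A center in the copy of z is handled by [center_nbr] if
    it is y and by [center_dist2] if it is x. *)
Let glued_half x y z t : S x y -> S y z -> S z t -> x <> z -> y <> t ->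
  Z x || Z y -> ~~ (Z z || Z t) -> glued_coloring z t <> k.
Proof.
move=> xy yz zt xz yt Zxy /[dup] nZ; rewrite /glued_coloring negb_or => /andP[nZz nZt].
rewrite (negPf nZz) (negPf nZt) /=.
case: (sierpinski_link_inner zt) => [/link_centers|[pzt szt]].
  by rewrite (negPf nZz) nZt.
case: (sierpinski_link_inner yz) => [lyz|[pyz syz]].
  have [a [b [_ Ez eab _ Zz]]] := link_center P lyz.
  by apply: (@noncenter_nbr b a); rewrite -?Zz // 1?es // -Ez; left.
case: (boolP (Z y)) => [/centerP[a [b [Ey eab Pab]]]|nZy].
  rewrite Ey in syz; apply: (center_nbr eab Pab syz szt) => Et; apply: yt.
  by apply: suffix3_inj => [i|]; rewrite ?Ey // pyz pzt.
move: Zxy; rewrite (negPf nZy) orbF => Zx.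
case: (sierpinski_link_inner xy) => [lxy|[pxy sxy]].
  have [a [b [_ Ey eab _ Zy]]] := link_center P lxy.
  by apply: (@noncenter_nbr b a); rewrite -?Zy // 1?es // -Ey; right.
have [a [b [Ex eab Pab]]] := centerP Zx.
rewrite Ex in sxy; apply: (center_dist2 eab Pab sxy syz szt).
  move=> Ez; apply: xz; apply: suffix3_inj => [i|]; last by rewrite Ex.
  by rewrite pxy.
by move=> E; apply: yt; apply: suffix3_inj => // i; rewrite pyz.
Qed.

Let inner_of u v : S u v -> ~~ (Z u || Z v) -> inner u v.
Proof. by case/sierpinski_link_inner => // /link_centers ->; rewrite orNb. Qed.

Lemma glued_coloringP : inj_edge_coloring S k glued_coloring.
Proof.
have range u v : S u v -> glued_coloring u v = glued_coloring v u /\ 1 <= glued_coloring u v <= k.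
  move=> uv; rewrite /glued_coloring orbC; case: ifPn => [_|nZ]; first by rewrite k1 leqnn.
  by rewrite orbC in nZ; have [_ suv] := inner_of uv nZ; case: cP => H _; apply: H.
split=> [//|x y z t xy yz zt _ _ /eqP xz /eqP ty _].
have yt : y <> t by move/esym.
case: (boolP (Z x || Z y)) => Zxy; case: (boolP (Z z || Z t)) => Zzt.
- by case: (center_path xy yz zt xz yt Zxy Zzt).
- by rewrite {1}/glued_coloring Zxy => /esym; apply: (glued_half xy yz zt).
- rewrite [glued_coloring z t]/glued_coloring Zzt; have [-> _] := range _ _ xy.
  rewrite sierpinski_sym in xy; rewrite sierpinski_sym in yz; rewrite sierpinski_sym in zt.
  by apply: (glued_half zt yz xy); rewrite 1?orbC // => /esym.
have [pxy sxy] := inner_of xy Zxy; have [pzt szt] := inner_of zt Zzt.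
have [lyz|[pyz syz]] := sierpinski_link_inner yz.
  (* A connecting middle edge would have a center at y or z. *)
  by move: Zxy Zzt; rewrite (link_centers lyz); case: (Z z); rewrite ?orbT.
rewrite /glued_coloring (negPf Zxy) (negPf Zzt).
apply: (inj_edge_coloring_neq (sierpinski3_irr ei) cP sxy syz szt) => E.
  by apply: xz; apply: suffix3_inj => // i; rewrite pxy.
by apply: yt; apply: suffix3_inj => // i; rewrite pyz.
Qed.

End GluedColoring.
End Suffix.
End Glue.

(** * Bounds for S^n from colourings of S^3 *)

Section CubeTransfer.
Variables (T : finType) (e : rel T).
Hypotheses (es : symmetric e) (ei : irreflexive e).
Variable t0 : T.
Local Notation s3 := (sierpinski3 e).
Local Notation S3 := (sierpinski e 3).
Local Notation tr := (embed3 0 t0).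
Local Notation sf := (@suffix3 T 0).

Lemma suffix3_inj0 : injective sf.
Proof. by move=> u v; apply: suffix3_inj; case. Qed.

Lemma suffix3_extreme u : sf (extreme 3 u) = (u, u, u).
Proof. by rewrite /suffix3 /extreme !ffunE. Qed.

Lemma embed3_extreme u : tr (u, u, u) = extreme 3 u.
Proof. by apply: suffix3_inj0; rewrite embed3K suffix3_extreme. Qed.

Lemma suffix3_adj u v : S3 u v -> s3 (sf u) (sf v).
Proof. by case/(sierpinski_link_inner (m := 0)) => [[[]]|[]]. Qed.

(** The words with constant prefix [t0] carry a copy of S^3, to which a colouring of S^n
    restricts. *)
Lemma inj_chromatic_index_sierpinski_ge n : 3 <= n ->
  inj_chromatic_index S3 <= inj_chromatic_index (sierpinski e n).
Proof.
move=> /subnK <-; move: (n - 3) => m; have [_ Hmin] := inj_chromatic_indexP S3.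
have [[c cP] _] := inj_chromatic_indexP (sierpinski e (m + 3)).
apply: Hmin; exists (fun u v => c (embed3 m t0 (sf u)) (embed3 m t0 (sf v))).
apply: inj_edge_coloring_comp cP => [|u v uv].
  by apply: inj_comp suffix3_inj0; apply: can_inj (embed3K m t0).
by apply: embed3_adj => //; apply: suffix3_adj.
Qed.

Lemma inj_edge_coloring_embed3 k c : inj_edge_coloring S3 k c ->
  inj_edge_coloring s3 k (fun p q => c (tr p) (tr q)).
Proof.
apply: inj_edge_coloring_comp => [|p q]; first exact: can_inj (embed3K 0 t0).
exact: (embed3_adj ei 0).
Qed.

(** An arbitrary choice of one end for each edge of G. *)
Definition rank_lt : rel T := fun a b => enum_rank a < enum_rank b.

Lemma rank_lt_asym a b : e a b -> rank_lt a b = ~~ rank_lt b a.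
Proof.
move=> eab; rewrite /rank_lt -leqNgt ltn_neqAle; case: eqP => // /ord_inj/enum_rank_inj E.
by rewrite E ei in eab.
Qed.

Lemma dist_ge2 (V : finType) (H : rel V) d x y : 2 <= d -> dist_ge H d x y -> x <> y /\ ~ H x y.
Proof.
move=> d2 D; split=> [E|xy]; first by have /negP := D 0 (ltnW d2); apply; apply/eqP.
have /negP := D 1 d2; apply; apply/orP; right; apply/existsP; exists y.
by rewrite xy /=.
Qed.

Lemma dist_ge3 (V : finType) (H : rel V) x y z : dist_ge H 3 x y -> H x z -> ~ H z y.
Proof.
move=> D xz zy; have /negP := D 2 isT; apply; apply/orP; right; apply/existsP; exists z.
rewrite xz /=; apply/orP; right; apply/existsP; exists y.
by rewrite zy /=.
Qed.

Section Upper.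
Hypothesis etf : triangle_free e.
Variables (n k : nat).
Hypotheses (n3 : 3 <= n) (k1 : 1 <= k).

(** Serves case (i) and also the general upper bound, where the last colour does not occur in [c]
    and the distance condition is vacuous. *)
Lemma sierpinski_colorable_far (c : T * T * T -> T * T * T -> nat) : inj_edge_coloring s3 k c ->
  (forall z t u, s3 z t -> c z t = k ->
     [/\ z <> (u, u, u), ~ s3 z (u, u, u) & forall w, s3 z w -> ~ s3 w (u, u, u)]) ->
  inj_colorable (sierpinski e n) k.
Proof.
move=> cP cfar; rewrite -(subnK n3); exists (glued_coloring e rank_lt k c).
have ss := sierpinski3_sym es.
apply: (glued_coloringP es ei (n - 3) etf rank_lt_asym k1 cP).
- by move=> a b z t _ _ az zt _ /(cfar _ _ a zt)[_ + _]; rewrite ss.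
- by move=> a b y z t _ _ ay yz zt _ _ /(cfar _ _ a zt)[_ _ /(_ y)]; rewrite ss => /(_ yz); rewrite ss.
- by move=> a b z t _ _ + zt /(cfar _ _ a zt)[+ + _] => + n1 n2; case=> //; rewrite ss.
Qed.

Lemma sierpinski_colorable_bip (A : {set T}) c :
  (forall x y, e x y -> (x \in A) != (y \in A)) -> extremal_coloring e A k c ->
  inj_colorable (sierpinski e n) k.
Proof.
move=> eA /(extremal_isolated_star es ei eA)[{}c [cP cA cB] cstar].
rewrite -(subnK n3); exists (glued_coloring e (fun a _ => a \in A) k c).
have nbr a q : s3 (a, a, a) q -> exists2 z, q = (a, a, z) & e a z.
  by move/sierpinski3_extreme; apply.
apply: (glued_coloringP es ei (n - 3) etf _ k1 cP).
- by move=> a b /eA; case: (a \in A); case: (b \in A).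
- by move=> a b z t _ aA /nbr[w -> aw] zt ta; apply: cstar zt ta.
(* The edge from aaa to y already has colour k in [c], so injectivity of [c] excludes k. *)
- move=> a b y z t _ aA ay yz zt az yt; rewrite -(cA a y aA ay); apply: nesym.
  exact: (inj_edge_coloring_neq (sierpinski3_irr ei) cP ay yz zt).
- move=> a b z t _ aA [->|/nbr[w -> aw]] zt; apply: cB => //; first by left.
  by right.
Qed.
End Upper.
End CubeTransfer.

Theorem mainTheorem6 (T : finType) (e : rel T) :
  simple_graph e -> triangle_free e -> has_edge e ->
  let S3 := sierpinski e 3 in
  let k := inj_chromatic_index S3 in
  (forall n, 3 <= n ->
     k <= inj_chromatic_index (sierpinski e n) <= k + 1) /\
  ((exists c, inj_edge_coloring S3 k c /\
      forall x y, S3 x y -> c x y = k ->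
        forall u : T, dist_ge S3 3 x (extreme 3 u))
   \/
   (exists A : {set T},
      (forall x y, e x y -> (x \in A) != (y \in A)) /\
      exists c, inj_edge_coloring S3 k c /\
        (forall u, u \in A -> forall y, S3 (extreme 3 u) y ->
           c (extreme 3 u) y = k) /\
        (forall x y, S3 x y -> c x y = k ->
           forall v : T, v \notin A -> dist_ge S3 2 x (extreme 3 v)))
   ->
   forall n, 3 <= n -> inj_chromatic_index (sierpinski e n) = k).
Proof.
move=> [es ei] etf [t0 [t1 e01]] S3 k.
have kP : inj_colorable S3 k by case: (inj_chromatic_indexP S3).
have S3sym : symmetric S3 by apply: sierpinski_sym.
have tr_adj p q : sierpinski3 e p q -> S3 (embed3 0 t0 p) (embed3 0 t0 q).
  exact: (embed3_adj ei 0).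
have lb n : 3 <= n -> k <= inj_chromatic_index (sierpinski e n).
  exact: inj_chromatic_index_sierpinski_ge.
have ub n K : inj_colorable (sierpinski e n) K -> inj_chromatic_index (sierpinski e n) <= K.
  by case: (inj_chromatic_indexP (sierpinski e n)) => _; apply.
split=> [n n3|].
  rewrite lb //=; apply: ub.
  case: kP => c /(inj_edge_coloring_embed3 ei t0) cP.
  apply: (sierpinski_colorable_far es ei etf n3 _ (c := fun p q => c (embed3 0 t0 p) (embed3 0 t0 q))).
  - by rewrite addn1.
  - case: cP => c1 c2; split=> // p q /c1[-> /andP[-> ck]]; split=> //=.
    by rewrite (leq_trans ck) // leq_addr.
  - move=> z t u zt E; case: cP => /(_ _ _ zt)[_ /andP[_]] + _.
    by rewrite E addn1 ltnn.
(* An edge of G yields an edge of S^3, which needs a colour. *)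
have k1 : 1 <= k.
  have e3 : sierpinski3 e (t0, t0, t0) (t0, t0, t1).
    by apply/sierpinski3P; apply: Or31; exists t1.
  by case: kP => c [/(_ _ _ (tr_adj _ _ e3))[_ /andP[H /(leq_trans H)]]].
move=> Hyp n n3; apply/eqP; rewrite eqn_leq lb // andbT; apply: ub.
case: Hyp => [[c [cP cfar]]|[A [eA [c [cP [cA cB]]]]]].
  apply: (sierpinski_colorable_far es ei etf n3 k1 (inj_edge_coloring_embed3 ei t0 cP)).
  move=> z t u /tr_adj zt ck; have D := cfar _ _ zt ck u.
  have [D1 D2] := @dist_ge2 _ _ 3 _ _ isT D; rewrite -(embed3_extreme t0) in D D1 D2.
  split=> [E|/tr_adj //|w /tr_adj zw /tr_adj]; last exact: (dist_ge3 D).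
  by rewrite E in D1.
apply: (sierpinski_colorable_bip es ei etf n3 k1 eA (c := fun p q => c (embed3 0 t0 p) (embed3 0 t0 q))).
split; first exact: inj_edge_coloring_embed3.
  by move=> u q uA /tr_adj; rewrite embed3_extreme; apply: cA.
move=> v z q vA vz /tr_adj zq /(cB _ _ zq)/(_ v vA)/(@dist_ge2 _ _ 2 _ _ isT)[].
rewrite -(embed3_extreme t0); case: vz => [-> //|evz] _; apply; rewrite S3sym; apply: tr_adj.
by apply/sierpinski3P; apply: Or31; exists z.
Qed.
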